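(* Let $p$ be an odd prime, $n$ a positive integer and $G=ES_1(p,n)$. (1) $\sigma\in Aut(G)$ is an inner automorphism if and only if $\overline{\sigma}=\mathrm{Id}_{2n\times 2n}$. In this case, writing $\sigma(\underline{u},\underline{w},z)=(\underline{u},\underline{w},\widetilde{\sigma}(\underline{u},\underline{w},z))$, one has $\widetilde{\sigma}(\underline{u},\underline{w},z)=\alpha(\underline{u})+\beta(\underline{w})+z$ for some $\alpha,\beta\in(\mathbb{F}_p^n)^{\vee}$, for every $(\underline{u},\underline{w},z)\in G$. (2) There is an exact sequence $$1\longrightarrow G/\mathcal{Z}(G)\cong Inn(G)\hookrightarrow Aut(G)\longrightarrow Sp^{scalar}(2n,\mathbb{F}_p)\longrightarrow 1,$$ where the map $Aut(G)\to Sp^{scalar}(2n,\mathbb{F}_p)$ is $\sigma\mapsto\overline{\sigma}$. (3) $|Aut(G)|=p^{2n}|Sp^{scalar}(2n,\mathbb{F}_p)|=p^{2n}(p-1)|Sp(2n,\mathbb{F}_p)|=p^{n^2+2n}(p-1)\prod_{j=1}^{n}(p^{2j}-1)$.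
   Context: $ES_1(p,n)$ is the set $\mathbb{F}_p^n\oplus\mathbb{F}_p^n\oplus\mathbb{F}_p$ with group operation $(\underline{u}^1,\underline{w}^1,z^1).(\underline{u}^2,\underline{w}^2,z^2)=(\underline{u}^1+\underline{u}^2,\underline{w}^1+\underline{w}^2,z^1+z^2+\langle\underline{u}^1,\underline{w}^2\rangle)$, where $\langle\underline{u},\underline{w}\rangle=\sum_{i=1}^nu_iw_i$. Its center is $\mathcal{Z}(G)=\{\underline{0}\}\oplus\{\underline{0}\}\oplus\mathbb{F}_p$, and $G/\mathcal{Z}(G)=\mathbb{F}_p^{2n}$ via $(\underline{u},\underline{w},z)\mapsto\begin{pmatrix}\underline{u}\\\underline{w}\end{pmatrix}$. For $\sigma\in Aut(G)$, $\overline{\sigma}\in GL_{2n}(\mathbb{F}_p)$ is (the matrix in the standard basis of) the induced automorphism of $G/\mathcal{Z}(G)$. $Inn(G)$ is the group of inner automorphisms, $V^{\vee}$ the dual space. With $\Delta=\begin{pmatrix}0_{n\times n}&I_{n\times n}\\-I_{n\times n}&0_{n\times n}\end{pmatrix}$, $Sp^{scalar}(2n,\mathbb{F}_p)=\{M\in GL_{2n}(\mathbb{F}_p)\mid M^t\Delta M=l\Delta\text{ for some }l\in\mathbb{F}_p^{*}\}$ and $Sp(2n,\mathbb{F}_p)=\{M\in GL_{2n}(\mathbb{F}_p)\mid M^t\Delta M=\Delta\}$. *)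

(* Defs.v *)
From HB Require Import structures.
From mathcomp Require Import all_boot all_order all_algebra all_fingroup all_solvable.

Set Implicit Arguments.
Unset Strict Implicit.
Unset Printing Implicit Defensive.

Import GroupScope GRing.Theory.
Local Open Scope ring_scope.

(* Vectors of F_p^n are columns, so that matrices act on the left. *)
Definition ES1 (p n : nat) : Type := ('cV['F_p]_n * 'cV['F_p]_n * 'F_p)%type.

Definition ES1_pairing p n (u w : 'cV['F_p]_n) : 'F_p :=
  \sum_(i < n) u i 0 * w i 0.

Definition ES1_mul p n (g h : ES1 p n) : ES1 p n :=
  let: (u1, w1, z1) := g in
  let: (u2, w2, z2) := h in
  (u1 + u2, w1 + w2, z1 + z2 + ES1_pairing u1 w2).

Definition ES1_one p n : ES1 p n := (0, 0, 0).

Definition ES1_inv p n (g : ES1 p n) : ES1 p n :=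
  let: (u, w, z) := g in (- u, - w, ES1_pairing u w - z).

Section ES1Group.
Variables p n : nat.
Implicit Types u w : 'cV['F_p]_n.

Lemma ES1_pairingDl u1 u2 w :
  ES1_pairing (u1 + u2) w = ES1_pairing u1 w + ES1_pairing u2 w.
Proof. by rewrite -big_split; apply: eq_bigr => i _; rewrite mxE mulrDl. Qed.

Lemma ES1_pairingDr u w1 w2 :
  ES1_pairing u (w1 + w2) = ES1_pairing u w1 + ES1_pairing u w2.
Proof. by rewrite -big_split; apply: eq_bigr => i _; rewrite mxE mulrDr. Qed.

Lemma ES1_pairing0l w : ES1_pairing 0 w = 0.
Proof. by rewrite /ES1_pairing big1 // => i _; rewrite mxE mul0r. Qed.

Lemma ES1_pairing0r u : ES1_pairing u 0 = 0.
Proof. by rewrite /ES1_pairing big1 // => i _; rewrite mxE mulr0. Qed.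

Lemma ES1_pairingNl u w : ES1_pairing (- u) w = - ES1_pairing u w.
Proof. by rewrite -sumrN; apply: eq_bigr => i _; rewrite mxE mulNr. Qed.

Lemma ES1_pairing_deltar u i : ES1_pairing u (delta_mx i 0) = u i 0.
Proof.
rewrite /ES1_pairing (bigD1 i) //= mxE !eqxx mulr1 big1 ?addr0 // => j ne_ji.
by rewrite mxE (negbTE ne_ji) mulr0.
Qed.

Lemma ES1_pairing_deltal w i : ES1_pairing (delta_mx i 0) w = w i 0.
Proof.
rewrite /ES1_pairing (bigD1 i) //= mxE !eqxx mul1r big1 ?addr0 // => j ne_ji.
by rewrite mxE (negbTE ne_ji) mul0r.
Qed.

Lemma ES1_mulA : associative (@ES1_mul p n).
Proof.
move=> [[u1 w1] z1] [[u2 w2] z2] [[u3 w3] z3] /=.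
rewrite !addrA ES1_pairingDl ES1_pairingDr !addrA; congr (_, _, _).
rewrite -!addrA; do 2!congr (_ + _).
by rewrite [RHS]addrCA; congr (_ + _); rewrite addrC -addrA.
Qed.

Lemma ES1_mul1 : left_id (@ES1_one p n) (@ES1_mul p n).
Proof. by move=> [[u w] z] /=; rewrite ES1_pairing0l !add0r addr0. Qed.

Lemma ES1_mulV : left_inverse (@ES1_one p n) (@ES1_inv p n) (@ES1_mul p n).
Proof.
by move=> [[u w] z] /=; rewrite ES1_pairingNl subrK !addNr addrN.
Qed.

HB.instance Definition _ := Finite.on (ES1 p n).
HB.instance Definition _ :=
  Finite_isGroup.Build (ES1 p n) ES1_mulA ES1_mul1 ES1_mulV.

End ES1Group.

Definition Inn (gT : finGroupType) (G : {group gT}) : {set {perm gT}} :=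
  conj_aut G @* G.

(* {perm T} multiplies permutations in diagrammatic order, (s * t) x = t (s x);
   aut_comp is the usual composition of functions. *)
Definition aut_comp (T : finType) (s t : {perm T}) : {perm T} := (t * s)%g.

(* The map G / Z(G) -> Inn(G) sending the class of g to x |-> g x g^-1;
   the inverse appears because conj_aut G g is x |-> x ^ g = g^-1 x g. *)
Definition quotient_conj (gT : finGroupType) (G : {group gT})
    (x : coset_of 'Z(G)) : {perm gT} :=
  conj_aut G (repr x)^-1.

(* The library action of Aut G on the quotient; see induced_aut_coset below. *)
Definition induced_aut (gT : finGroupType) (G : {group gT}) (s : {perm gT})
    (x : coset_of 'Z(G)) : coset_of 'Z(G) :=
  ([Aut G] / 'Z(G))%act x s.

Section ES1Bar.
Variables p n : nat.
Let G := [set: ES1 p n]%G.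

Definition ES1_vec (g : ES1 p n) : 'cV['F_p]_(n + n) := col_mx g.1.1 g.1.2.

Definition ES1_lift (v : 'cV['F_p]_(n + n)) : ES1 p n :=
  (usubmx v, dsubmx v, 0).

(* The identification G / Z(G) = F_p^(2n) and its inverse. *)
Definition quot_vec (x : coset_of 'Z(G)) : 'cV['F_p]_(n + n) :=
  ES1_vec (repr x).

Definition vec_quot (v : 'cV['F_p]_(n + n)) : coset_of 'Z(G) :=
  coset 'Z(G) (ES1_lift v).

(* The matrix, in the standard basis of F_p^(2n), of the automorphism of
   G / Z(G) induced by s. *)
Definition ES1_bar (s : {perm (ES1 p n)}) : 'M['F_p]_(n + n) :=
  \matrix_(i, j) quot_vec (induced_aut s (vec_quot (delta_mx j 0))) i 0.

Lemma ES1_mulE (g h : ES1 p n) : (g * h)%g = ES1_mul g h.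
Proof. by []. Qed.

Lemma ES1_vecM (g h : ES1 p n) : ES1_vec (g * h)%g = ES1_vec g + ES1_vec h.
Proof. by case: g h => [[u1 w1] z1] [[u2 w2] z2]; rewrite /ES1_vec add_col_mx. Qed.

Lemma ES1_liftK : cancel ES1_lift ES1_vec.
Proof. by move=> v; rewrite /ES1_vec vsubmxK. Qed.

Lemma ES1_centerE :
  'Z(G) = [set g : ES1 p n | (g.1.1 == 0) && (g.1.2 == 0)] :> {set _}.
Proof.
apply/setP => -[[u w] z]; rewrite inE in_setT inE /=.
apply/centP/andP => [cG | [/eqP-> /eqP->] [[u' w'] z'] _]; last first.
  rewrite /commute !ES1_mulE /= !ES1_pairing0l ES1_pairing0r !addr0 !add0r.
  by rewrite addrC.
split; apply/eqP/matrixP => i j; rewrite ord1 mxE.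
  have /(congr1 snd) := cG (0, delta_mx i 0, 0) (in_setT _).
  by rewrite !ES1_mulE /= ES1_pairing_deltar ES1_pairing0l addr0 add0r => /addrI.
have /(congr1 snd) := cG (delta_mx i 0, 0, 0) (in_setT _).
rewrite !ES1_mulE /= ES1_pairing_deltal ES1_pairing0r add0r !addr0.
by rewrite -[X in X = _]addr0 => /addrI.
Qed.

Lemma ES1_in_center g : (g \in 'Z(G)) = (g.1.1 == 0) && (g.1.2 == 0).
Proof. by rewrite ES1_centerE inE. Qed.

Lemma ES1_center_norm (g : ES1 p n) : g \in 'N('Z(G)).
Proof. exact: subsetP (normal_norm (center_normal G)) g (in_setT g). Qed.

Lemma ES1_vec_coset g : quot_vec (coset 'Z(G) g) = ES1_vec g.
Proof.
rewrite /quot_vec /=; have := mem_repr_coset (coset 'Z(G) g).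
rewrite val_coset ?ES1_center_norm //; case/rcosetP => z Zz ->.
rewrite ES1_vecM.
have /andP[/eqP u0 /eqP w0] := etrans (esym (ES1_in_center z)) Zz.
by rewrite {1}/ES1_vec u0 w0 col_mx0 add0r.
Qed.

Lemma vec_quotK : cancel vec_quot quot_vec.
Proof. by move=> v; rewrite ES1_vec_coset ES1_liftK. Qed.

Lemma quot_vecK : cancel quot_vec vec_quot.
Proof.
move=> x; rewrite -[RHS]coset_reprK /vec_quot /quot_vec.
case: (repr x) => [[u w] z]; rewrite /ES1_lift /ES1_vec /= col_mxKu col_mxKd.
have ->: (u, w, z) = (((0, 0, z) : ES1 p n) * ((u, w, 0) : ES1 p n))%g.
  by rewrite ES1_mulE /= ES1_pairing0l !add0r !addr0.
by rewrite coset_kerl // ES1_in_center /= !eqxx.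
Qed.

Lemma quot_vecM x y : quot_vec (x * y)%g = quot_vec x + quot_vec y.
Proof.
rewrite -(quot_vecK x) -(quot_vecK y) -coset_morphM ?ES1_center_norm //.
by rewrite !ES1_vec_coset ES1_vecM.
Qed.

Lemma induced_aut_coset s g :
  s \in Aut G -> induced_aut s (coset 'Z(G) g) = coset 'Z(G) (s g).
Proof.
move=> AutGs; rewrite /induced_aut /= qactE ?ES1_center_norm //.
rewrite qact_domE ?center_sub //; apply/setIP; split=> //; rewrite inE.
apply/subsetP => x Zx; rewrite inE /= -[X in X \in _]/(s x) -(autmE AutGs).
have /charP[_ chZ] := center_char G.
have := mem_morphim (autm_morphism AutGs) (in_setT x) Zx.
by rewrite (chZ _ (injm_autm AutGs) (im_autm AutGs)).
Qed.

Lemma induced_autM s :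
  s \in Aut G -> {morph @induced_aut _ G s : x y / (x * y)%g >-> (x * y)%g}.
Proof.
move=> AutGs x y; rewrite -(coset_reprK x) -(coset_reprK y).
rewrite -coset_morphM ?ES1_center_norm // !induced_aut_coset //.
rewrite -coset_morphM ?ES1_center_norm //; congr (coset _ _).
by rewrite -!(autmE AutGs) morphM ?in_setT.
Qed.

Lemma ES1_barE s x : s \in Aut G ->
  quot_vec (induced_aut s x) = ES1_bar s *m quot_vec x.
Proof.
move=> AutGs; pose f v := quot_vec (induced_aut s (vec_quot v)).
have vqD u v : vec_quot (u + v) = (vec_quot u * vec_quot v)%g.
  by apply: (can_inj quot_vecK); rewrite quot_vecM !vec_quotK.
have fD u v : f (u + v) = f u + f v.
  by rewrite /f vqD induced_autM // quot_vecM.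
have f0 : f 0 = 0 by apply: (@addrI _ (f 0)); rewrite -fD !addr0.
have fMn v k : f (v *+ k) = f v *+ k.
  by elim: k => [|k IHk]; rewrite ?mulr0n // !mulrS fD IHk.
have fZ (a : 'F_p) v : f (a *: v) = a *: f v.
  by rewrite -[a]natr_Zp !scaler_nat fMn.
have fS v : f v = \sum_j v j 0 *: f (delta_mx j 0).
  rewrite {1}[v]matrix_sum_delta (big_morph f fD f0); apply: eq_bigr => j _.
  by rewrite big_ord1 fZ.
rewrite -{1}(quot_vecK x) -/(f _) fS; apply/matrixP => i j.
rewrite ord1 summxE mxE; apply: eq_bigr => k _.
by rewrite !mxE mulrC.
Qed.

End ES1Bar.

Section Symplectic.
Variables p n : nat.

Definition symplectic_form : 'M['F_p]_(n + n) :=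
  block_mx 0 1%:M (- 1%:M) 0.

Definition Sp : {set 'M['F_p]_(n + n)} :=
  [set M | (M \in unitmx)
         && (M^T *m symplectic_form *m M == symplectic_form)].

Definition Sp_scalar : {set 'M['F_p]_(n + n)} :=
  [set M | (M \in unitmx) &&
    [exists l : 'F_p, (l != 0)
      && (M^T *m symplectic_form *m M == l *: symplectic_form)]].

Lemma Sp_scalar1 : 1%:M \in Sp_scalar.
Proof.
rewrite inE unitmx1; apply/existsP; exists 1.
by rewrite oner_neq0 trmx1 mul1mx mulmx1 scale1r eqxx.
Qed.

Lemma Sp_scalarM M N :
  M \in Sp_scalar -> N \in Sp_scalar -> M *m N \in Sp_scalar.
Proof.
rewrite !inE => /andP[uM /existsP[k /andP[k0 /eqP eM]]].
move=> /andP[uN /existsP[l /andP[l0 /eqP eN]]].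
rewrite unitmx_mul uM uN; apply/existsP; exists (k * l).
rewrite mulf_neq0 // trmx_mul !mulmxA -2!(mulmxA N^T) eM.
by rewrite -scalemxAr -scalemxAl eN scalerA eqxx.
Qed.

Lemma Sp_scalarV M : M \in Sp_scalar -> invmx M \in Sp_scalar.
Proof.
rewrite !inE unitmx_inv => /andP[uM /existsP[l /andP[l0 /eqP eM]]].
rewrite uM; apply/existsP; exists l^-1; rewrite invr_eq0 l0 /=.
apply/eqP; apply: (scalerI l0); rewrite scalerA divff // scale1r.
rewrite scalemxAl scalemxAr -eM -!mulmxA mulmxV // mulmx1 mulmxA.
by rewrite -trmx_mul mulmxV // trmx1 mul1mx.
Qed.

End Symplectic.

(* 1 -> K -> A -> Q -> 1 is an exact sequence of finite groups, each given by a
   set, with its law; oneQ is the neutral element of Q. *)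
Record short_exact (TK TA TQ : finType)
    (K : {set TK}) (mulK : TK -> TK -> TK)
    (A : {set TA}) (mulA : TA -> TA -> TA)
    (Q : {set TQ}) (mulQ : TQ -> TQ -> TQ) (oneQ : TQ)
    (i : TK -> TA) (q : TA -> TQ) : Prop := ShortExact {
  exact_in_sub : {in K, forall x, i x \in A};
  exact_inM : {in K &, forall x y, i (mulK x y) = mulA (i x) (i y)};
  exact_in_inj : {in K &, injective i};
  exact_out_sub : {in A, forall a, q a \in Q};
  exact_outM : {in A &, forall a b, q (mulA a b) = mulQ (q a) (q b)};
  exact_im_ker : i @: K = [set a in A | q a == oneQ];
  exact_out_surj : q @: A = Q
}.

(* Main.v *)
Require Import Defs.
From mathcomp Require Import all_boot all_order all_algebra all_fingroup all_solvable.
From HB Require Import structures.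
From mathcomp Require Import ring zify.
Import GroupScope GRing.Theory.
Local Open Scope ring_scope.

Set Implicit Arguments.
Unset Strict Implicit.
Unset Printing Implicit Defensive.

(* Commutators in G = ES_1(p,n) compute the symplectic form, so an automorphism
   acting on the centre as multiplication by l induces a similitude of ratio l
   on F_p^(2n). If the induced matrix is 1 then l = 1, the automorphism adds a
   linear form to the last coordinate, and every linear form arises from a
   conjugation. Conversely, a similitude M of ratio l lifts to
   (v, z) |-> (M v, l z + v^T S v / 2), where S = M^T E M - l E and E is the
   matrix of the bilinear form (v, v') |-> <u, w'> in the group law; this is a
   morphism because S is symmetric. The order of Sp(2n) counts hyperbolic
   frames, a frame of k pairs in dimension m having
   (q^(m-2k) - 1) q^(m-2k-1) extensions by one more pair. *)

Lemma card_eq_fibers (T U : finType) (A : {set T}) (B : {set U}) (f : T -> U)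
    (c : nat) :
  {in A, forall a, f a \in B} ->
  {in B, forall b, #|[set a in A | f a == b]| = c} ->
  #|A| = (#|B| * c)%N.
Proof.
move=> fAB fc; rewrite -sum1_card (partition_big f (mem B)) //=.
rewrite (eq_bigr (fun=> c)) ?sum_nat_const // => b Bb.
by rewrite -(fc b Bb) -sum1_card; apply: eq_bigl => a; rewrite inE.
Qed.

(** * Counting hyperbolic frames of a nondegenerate alternating form *)

Section Frames.
Variable F : finFieldType.
Let q := #|F|.

Lemma q_expn_gt0 r : (0 < q ^ r)%N.
Proof. by rewrite expn_gt0; apply/orP; left; apply/card_gt0P; exists 0. Qed.

(** A right inverse makes [A] surjective, and translation by [B *m (b - c)] carries the fibre over
    [c] onto the fibre over [b]. All [q ^ r] fibres thus have the same size in a space of size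
    [q ^ m]. *)
Lemma card_right_inverse_solutions r m (A : 'M[F]_(r, m)) (B : 'M[F]_(m, r))
    (b : 'cV[F]_r) :
  A *m B = 1%:M -> #|[set x : 'cV[F]_m | A *m x == b]| = (q ^ (m - r))%N.
Proof.
move=> AB1; apply/eqP; rewrite -(eqn_pmul2l (q_expn_gt0 r)) -expnD.
rewrite subnKC ?(mulmx1_min AB1) //; apply/eqP.
have -> : (q ^ m = #|[set: 'cV[F]_m]|)%N by rewrite cardsT card_mx muln1.
have -> : (q ^ r = #|[set: 'cV[F]_r]|)%N by rewrite cardsT card_mx muln1.
apply/esym/(@card_eq_fibers _ _ _ _ (mulmx A)) => [x _|c _]; first exact: in_setT.
rewrite -(card_imset _ (addrI (B *m (b - c)))).
apply: eq_card => x; rewrite [RHS]inE; apply/imsetP/eqP => [[y] | Axb].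
  rewrite !inE => /eqP Ayc ->.
  by rewrite mulmxDr mulmxA AB1 mul1mx Ayc subrK.
exists (x - B *m (b - c)); last by rewrite addrC subrK.
by rewrite !inE mulmxBr Axb mulmxA AB1 mul1mx opprB addrC subrK eqxx.
Qed.

Variables (m : nat) (A : 'M[F]_m).
Hypotheses (A_unit : A \in unitmx) (A_skew : A^T = - A).
Hypothesis A_alt : forall x : 'cV[F]_m, x^T *m A *m x = 0.

(* Hyperbolic pairs (e_i, f_i), stored as the columns of X.1 and of X.2. *)
Definition is_frame k (X : 'M[F]_(m, k) * 'M[F]_(m, k)) : bool :=
  [&& X.1^T *m A *m X.1 == 0, X.2^T *m A *m X.2 == 0 & X.1^T *m A *m X.2 == 1%:M].

Lemma form_tr j k (X : 'M[F]_(m, j)) (Y : 'M[F]_(m, k)) :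
  (X^T *m A *m Y)^T = - (Y^T *m A *m X).
Proof. by rewrite !trmx_mul trmxK A_skew mulNmx mulmxN mulmxA. Qed.

Lemma form_eq0C j k (X : 'M[F]_(m, j)) (Y : 'M[F]_(m, k)) :
  (X^T *m A *m Y == 0) = (Y^T *m A *m X == 0).
Proof. by rewrite -oppr_eq0 -form_tr trmx_eq0. Qed.

(** This form allows counting in two stages: a linear system on [x] alone, then, once [x] is fixed,
    a linear system on [y]. The other blocks follow by skew symmetry and from [A_alt]. *)
Lemma frame_cons k (x y : 'cV[F]_m) (X Y : 'M[F]_(m, k)) :
  is_frame (row_mx x X, row_mx y Y) =
  [&& is_frame (X, Y),
      col_mx (X^T *m A) (Y^T *m A) *m x == 0 &
      col_mx (x^T *m A) (col_mx (X^T *m A) (Y^T *m A)) *m y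
        == col_mx 1%:M 0].
Proof.
rewrite /is_frame /= !tr_row_mx !(mul_col_mx _ _ A) !mul_col_row !A_alt !mul_col_mx.
have e0 j k1 k2 : (0 : 'M[F]_(j + k1, k2)) = col_mx 0 0 by rewrite col_mx0.
have b0 : (0 : 'M[F]_(1 + k)) = block_mx 0 0 0 0 by rewrite block_mx0.
have b1 : (1%:M : 'M[F]_(1 + k)) = block_mx 1%:M 0 0 1%:M by rewrite -scalar_mx_block.
rewrite b0 b1 (e0 k k).
apply/idP/idP.
  case/and3P=> /eqP/eq_block_mx[_ xX Xx XX] /eqP/eq_block_mx[_ yY Yy YY].
  move=> /eqP/eq_block_mx[xy xY Xy XY].
  have Yx : Y^T *m A *m x = 0 by apply/eqP; rewrite form_eq0C xY.
  by rewrite XX YY XY Xx Yx xy Xy Yy !col_mx0 !eqxx.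
case/and3P=> /and3P[/eqP XX /eqP YY /eqP XY] /eqP.
rewrite col_mx0 => /eqP; rewrite col_mx_eq0 => /andP[Xx Yx].
move=> /eqP/eq_col_mx[xy]; rewrite -[0](@col_mx0 _ k k 1) => /eq_col_mx[Xy Yy].
have xX : x^T *m A *m X = 0 by apply/eqP; rewrite form_eq0C.
have xY : x^T *m A *m Y = 0 by apply/eqP; rewrite form_eq0C.
have yY : y^T *m A *m Y = 0 by apply/eqP; rewrite form_eq0C Yy.
by rewrite XX YY XY xX xY yY xy Xy Yy (eqP Xx) !eqxx.
Qed.

(** The columns of [Y] and of [- X] are dual to the functionals pairing with those of [X] and of
    [Y], so the [2k] orthogonality equations are independent. *)
Lemma frame_right_inverse k (X Y : 'M[F]_(m, k)) : is_frame (X, Y) ->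
  col_mx (X^T *m A) (Y^T *m A) *m row_mx Y (- X) = 1%:M.
Proof.
case/and3P=> /= /eqP XX /eqP YY /eqP XY.
have YX : Y^T *m A *m X = - 1%:M.
  by rewrite -[LHS]opprK -form_tr XY trmx1.
by rewrite mul_col_row !mulmxN XX YY XY YX oppr0 opprK -scalar_mx_block.
Qed.

(** The equation from [x] is independent of those of the frame: nondegeneracy gives [y] pairing to 1
    with [x], and removing its component [Q *m (P *m y)] along the frame keeps that value, as [x] is
    orthogonal to the frame. *)
Lemma frame_right_inverse1 k (X Y : 'M[F]_(m, k)) (x : 'cV[F]_m) :
  is_frame (X, Y) -> x != 0 -> col_mx (X^T *m A) (Y^T *m A) *m x = 0 ->
  exists B, col_mx (x^T *m A) (col_mx (X^T *m A) (Y^T *m A)) *m B = 1%:M.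
Proof.
move=> frXY x0; set P := col_mx (X^T *m A) _ => Px0.
set Q := row_mx Y (- X); have PQ : P *m Q = 1%:M by apply: frame_right_inverse.
have xQ : x^T *m A *m Q = 0.
  move: Px0; rewrite /P /Q mul_col_mx mul_mx_row mulmxN.
  move=> /eqP; rewrite col_mx_eq0 form_eq0C => /andP[/eqP-> ].
  by rewrite form_eq0C => /eqP->; rewrite oppr0 row_mx0.
have [y xy] : exists y, x^T *m A *m y = 1%:M.
  have /matrix0Pn[i [j xAj]] : x^T *m A != 0.
    apply: contraNneq x0 => xA0; rewrite -trmx_eq0 -[x^T](mulmxK A_unit).
    by rewrite xA0 mul0mx eqxx.
  move: (x^T *m A) xAj => N Nij; exists ((N i j)^-1 *: delta_mx j 0).
  by apply/matrixP=> a b; rewrite -scalemxAr -colE !mxE !ord1 in Nij *; rewrite mulVf.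
exists (row_mx (y - Q *m (P *m y)) Q).
rewrite mul_col_row PQ xQ mulmxBr xy (mulmxA (x^T *m A)) xQ mul0mx subr0.
by rewrite mulmxBr (mulmxA P) PQ mul1mx subrr -scalar_mx_block.
Qed.

(** The first vector is any nonzero vector of the orthogonal of the frame, of dimension [m - 2k];
    the second then solves [2k + 1] independent equations. *)
Lemma card_frame_extensions k (X Y : 'M[F]_(m, k)) : is_frame (X, Y) ->
  (k.*2 < m)%N ->
  #|[set v : 'cV[F]_m * 'cV[F]_m | is_frame (row_mx v.1 X, row_mx v.2 Y)]| =
  ((q ^ (m - k.*2) - 1) * q ^ (m - k.*2 - 1))%N.
Proof.
move=> frXY km; set P := col_mx (X^T *m A) (Y^T *m A).
have cK : #|[set x : 'cV[F]_m | P *m x == 0] :\ 0| = (q ^ (m - k.*2) - 1)%N.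
  rewrite -addnn -(card_right_inverse_solutions 0 (frame_right_inverse frXY)).
  by rewrite -/P [in RHS](cardsD1 0) inE mulmx0 eqxx addnC addnK.
rewrite -cK; apply: (@card_eq_fibers _ _ _ _ (fun v => v.1)) => [[x y]|x].
  rewrite !inE /= frame_cons -/P => /and3P[_ -> /eqP Py]; rewrite andbT.
  (* For [x = 0] the first equation on [y] would read 0 = 1. *)
  apply: contra_eqN Py => /eqP->; rewrite trmx0 mul0mx mul_col_mx mul0mx.
  by apply/eqP => /eq_col_mx[/matrixP/(_ 0 0)/eqP]; rewrite !mxE eq_sym oner_eq0.
rewrite !inE => /andP[x0 Px].
have [B xPB] := frame_right_inverse1 frXY x0 (eqP Px).
rewrite -subnDA addn1 -addnn -[(k + k).+1]add1n.
rewrite -(card_right_inverse_solutions (col_mx 1%:M 0) xPB).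
rewrite -[RHS](card_imset _ (_ : injective (pair x))) => [|y z []//].
apply: eq_card => -[z y]; rewrite !inE /= frame_cons -/P.
apply/idP/imsetP => [/andP[/and3P[_ _ Py] /eqP <-] | [t]].
  by exists y; rewrite ?inE.
by rewrite inE => Pt [-> ->]; rewrite frXY Px Pt eqxx.
Qed.

Lemma card_frames k : (k.*2 <= m)%N ->
  #|[set X : 'M[F]_(m, k) * 'M[F]_(m, k) | is_frame X]| =
  (\prod_(i < k) ((q ^ (m - i.*2) - 1) * q ^ (m - i.*2 - 1)))%N.
Proof.
elim: k => [|k IHk] km.
  rewrite big_ord0 -(card1 (0 : 'M[F]_(m, 0) * 'M[F]_(m, 0))).
  apply: eq_card => -[X Y]; rewrite !inE /is_frame !(flatmx0 (_ *m _)) /=.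
  by rewrite (flatmx0 1%:M) !(thinmx0 X) !(thinmx0 Y) !eqxx.
have km' : (k.*2 < m)%N by apply: leq_trans km; rewrite doubleS.
rewrite big_ord_recr /= -IHk ?(ltnW km') //.
(* The map forgets the first pair. Writing [k.+1] as [1 + k], which is convertible to it, lets
   [rsubmx] drop one column. *)
apply: (@card_eq_fibers _ _ _ _
  (fun X : 'M_(m, 1 + k) * 'M_(m, 1 + k) => (rsubmx X.1, rsubmx X.2))).
  move=> [X Y]; rewrite !inE -(hsubmxK (X : 'M_(m, 1 + k))).
  rewrite -(hsubmxK (Y : 'M_(m, 1 + k))) /= !row_mxKr.
  by rewrite frame_cons => /and3P[].
move=> [X Y]; rewrite inE => frXY; rewrite -(card_frame_extensions frXY km').
rewrite -(card_imset _ (_ : injective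
  (fun v : 'cV[F]_m * 'cV[F]_m => (row_mx v.1 X, row_mx v.2 Y)))); last first.
  by move=> [x y] [x' y'] [/eq_row_mx[-> _] /eq_row_mx[-> _]].
apply: eq_card => -[X' Y']; rewrite !inE /=; apply/andP/imsetP.
  move=> [fr /eqP[eX eY]].
  exists (lsubmx (X' : 'M_(m, 1 + k)), lsubmx (Y' : 'M_(m, 1 + k))).
    by rewrite inE /= -{1}eX -{1}eY !hsubmxK.
  by rewrite /= -{1}eX -{1}eY !hsubmxK.
by move=> [[x y]]; rewrite inE /= => fr [-> ->]; rewrite fr !row_mxKr eqxx.
Qed.
End Frames.

(** * Auxiliary facts on bilinear forms and additive maps *)

Lemma bilinear_mx_inj (R : comNzRingType) m k (A B : 'M[R]_(m, k)) :
  (forall (x : 'cV_m) (y : 'cV_k), x^T *m A *m y = x^T *m B *m y) -> A = B.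
Proof.
move=> AB; apply/matrixP => i j.
have := AB (delta_mx i 0) (delta_mx j 0).
by rewrite trmx_delta -!rowE -!colE => /matrixP/(_ 0 0); rewrite !mxE.
Qed.

(** Every scalar of ['F_p] is the image of a natural number, so additivity suffices. *)
Lemma Fp_additive_scalable (p : nat) (V : lmodType 'F_p) (f : V -> 'F_p) :
  {morph f : x y / x + y} -> forall a x, f (a *: x) = a * f x.
Proof.
move=> fD a x; have f0 : f 0 = 0 by apply: (@addrI _ (f 0)); rewrite -fD !addr0.
have fMn k : f (x *+ k) = f x *+ k.
  by elim: k => [|k IHk]; rewrite ?mulr0n // !mulrS fD IHk.
by rewrite -[a]natr_Zp scaler_nat fMn mulr_natl.
Qed.

(** Provides a similitude of each prescribed ratio [l]. *)
Lemma block_scalar_symplectic (R : comNzRingType) n (l : R) :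
  (block_mx l%:M 0 0 1%:M)^T *m block_mx 0 1%:M (- 1%:M) 0
    *m block_mx l%:M 0 0 1%:M = l *: block_mx 0 1%:M (- 1%:M) 0 :> 'M_(n + n).
Proof.
rewrite tr_block_mx !tr_scalar_mx !trmx0 !mulmx_block scale_block_mx.
rewrite !mulmx0 !mul0mx !add0r !addr0 !mul0mx !mulmx1 !mul1mx.
by rewrite !scaler0 mulNmx mul1mx scalerN scalemx1.
Qed.

(** * Orders of the symplectic group and of the group of similitudes *)

Section SymplecticOrder.
Variables p n : nat.
Local Notation J := (symplectic_form p n).

Lemma symplectic_form_tr : J^T = - J.
Proof.
rewrite /symplectic_form tr_block_mx opp_block_mx linearN /= !trmx0 trmx1.
by rewrite !oppr0 opprK.
Qed.

Lemma symplectic_form_unit : J \in unitmx.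
Proof.
have /mulmx1_unit[Ju _] : J *m (- J) = 1%:M; last exact: Ju.
rewrite /symplectic_form opp_block_mx mulmx_block !opprK !oppr0.
by rewrite !(mulmx0, mul0mx, mulmx1, mulmxN, addr0, add0r) opprK -scalar_mx_block.
Qed.

Lemma symplectic_formE (x y : 'cV['F_p]_(n + n)) :
  (x^T *m J *m y) 0 0 =
  ES1_pairing (usubmx x) (dsubmx y) - ES1_pairing (usubmx y) (dsubmx x).
Proof.
rewrite -[in LHS](vsubmxK x) -[in LHS](vsubmxK y) tr_col_mx.
rewrite mul_row_block mul_row_col !mulmx0 !mulmxN !mulmx1 add0r addr0.
rewrite mulNmx addrC !mxE; congr (_ - _); apply: eq_bigr => i _; rewrite !mxE //.
by rewrite mulrC.
Qed.

Lemma symplectic_form_alt (x : 'cV['F_p]_(n + n)) : x^T *m J *m x = 0.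
Proof. by apply/matrixP=> i j; rewrite !ord1 symplectic_formE subrr mxE. Qed.

(** Since [J] is invertible, the equation forces [M] to be invertible. *)
Lemma in_Sp M : (M \in Sp p n) = (M^T *m J *m M == J).
Proof.
rewrite inE andb_idl // => /eqP MJM.
by have := symplectic_form_unit; rewrite -MJM !unitmx_mul => /andP[].
Qed.

Lemma in_Sp_scalar M :
  reflect (exists2 l : 'F_p, l != 0 & M^T *m J *m M = l *: J)
          (M \in Sp_scalar p n).
Proof.
rewrite inE; apply: (iffP andP) => [[_ /existsP[l /andP[l0 /eqP MJM]]] | [l l0 MJM]].
  by exists l.
split; last by apply/existsP; exists l; rewrite l0 MJM eqxx.
have : l *: J \in unitmx.
  by rewrite unitmxZ ?unitfE // symplectic_form_unit.
by rewrite -MJM !unitmx_mul => /andP[].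
Qed.

Hypothesis p_prime : prime p.

(** The blocks of [M^T *m J *m M = J] say exactly that the left and right halves of the columns of
    [M] form a frame of [n] pairs. *)
Lemma card_Sp_frames :
  #|Sp p n| = (\prod_(i < n) ((p ^ (n + n - i.*2) - 1) * p ^ (n + n - i.*2 - 1)))%N.
Proof.
have := card_frames symplectic_form_unit symplectic_form_tr symplectic_form_alt.
move=> /(_ n); rewrite -addnn leqnn card_Fp // => <- //.
pose split (M : 'M['F_p]_(n + n)) := (lsubmx M, rsubmx M).
have split_inj : injective split.
  by move=> M N [eql eqr]; rewrite -[M]hsubmxK -[N]hsubmxK eql eqr.
rewrite -(card_imset _ split_inj).
have frameE X Y : is_frame J (X, Y) = (row_mx X Y \in Sp p n).
  rewrite in_Sp /is_frame /= tr_row_mx mul_col_mx mul_col_row.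
  apply/and3P/eqP => [[/eqP-> /eqP YY /eqP XY] | ].
    rewrite YY XY; congr block_mx.
    by rewrite -[LHS]opprK -(form_tr symplectic_form_tr) XY trmx1.
  by rewrite [RHS]/symplectic_form => /eq_block_mx[-> -> _ ->].
apply: eq_card => -[X Y]; rewrite [RHS]inE frameE.
apply/imsetP/idP => [[M SpM [-> ->]] | SpXY]; first by rewrite hsubmxK.
by exists (row_mx X Y); rewrite // /split row_mxKl row_mxKr.
Qed.

Lemma card_Sp :
  #|Sp p n| = (p ^ (n ^ 2) * \prod_(1 <= j < n.+1) (p ^ (2 * j) - 1))%N.
Proof.
(* Reversing the index turns the exponent [2n - 2i] into [2(i + 1)]. *)
rewrite card_Sp_frames (reindex_inj rev_ord_inj) /=.
rewrite big_add1 /= big_mkord.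
(* The remaining powers have the odd exponents 1, 3, ..., 2n - 1, of sum [n ^ 2]. *)
have -> : (p ^ (n ^ 2) = \prod_(i < n) p ^ (i.*2.+1))%N.
  elim: (n) => [|k IHk]; first by rewrite big_ord0.
  rewrite big_ord_recr /= -IHk -expnD; congr (p ^ _)%N.
  by rewrite -!mulnn; lia.
rewrite -big_split; apply: eq_bigr => i _ /=; rewrite mulnC.
by have := ltn_ord i => ltin; congr (p ^ _ * (p ^ _ - 1))%N; lia.
Qed.

Hypothesis n_gt0 : (0 < n)%N.

Lemma scale_symplectic_form_inj : injective (fun l : 'F_p => l *: J).
Proof.
move=> k l /matrixP/(_ (lshift n (Ordinal n_gt0)) (rshift n (Ordinal n_gt0))).
by rewrite [LHS]mxE [RHS]mxE !block_mxEur !mxE eqxx !mulr1.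
Qed.

(** Each similitude is uniquely [D l *m N] with [l] nonzero and [N] symplectic: its ratio determines
    [l], and dividing by [D l] leaves a similitude of ratio 1. *)
Lemma card_Sp_scalar : #|Sp_scalar p n| = ((p - 1) * #|Sp p n|)%N.
Proof.
pose D (l : 'F_p) : 'M_(n + n) := block_mx l%:M 0 0 1%:M.
have DJD l : (D l)^T *m J *m D l = l *: J.
  exact: block_scalar_symplectic.
have D_unit l : l != 0 -> D l \in unitmx.
  move=> l0; have : l *: J \in unitmx.
    by rewrite unitmxZ ?unitfE // symplectic_form_unit.
  by rewrite -DJD !unitmx_mul => /andP[].
have DMJ l M : M \in Sp p n -> (D l *m M)^T *m J *m (D l *m M) = l *: J.
  rewrite in_Sp => /eqP MJM.
  by rewrite trmx_mul !mulmxA -2!(mulmxA M^T) DJD -scalemxAr -scalemxAl MJM.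
have -> : (p - 1 = #|[set~ 0%R : 'F_p]|)%N by rewrite cardsC1 card_Fp // subn1.
rewrite -cardsX -(card_in_imset (f := fun x => D x.1 *m x.2)); last first.
  move=> [k M] [l N] /setXP[_ SpM] /setXP[/[!in_setC1] l0 SpN] /= eDM.
  have ekl : k = l by apply: scale_symplectic_form_inj; rewrite -(DMJ k M) // eDM DMJ.
  by move: eDM; rewrite ekl => /(can_inj (mulKmx (D_unit l l0)))->.
apply: eq_card => M; apply/in_Sp_scalar/imsetP => [[l l0 MJM] | [[l N]]].
  have [N DK] : exists N, D l *m N = M.
    by exists (invmx (D l) *m M); rewrite mulKVmx ?D_unit.
  exists (l, N) => //; apply/setXP; rewrite in_setC1 in_Sp.
  split=> //; apply/eqP/(scalerI l0); rewrite -MJM -[in RHS]DK trmx_mul !mulmxA.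
  by rewrite -[in RHS](mulmxA N^T) -[in RHS](mulmxA N^T) DJD -scalemxAr -scalemxAl.
by case/setXP => /[!in_setC1] l0 SpN ->; exists l; rewrite ?DMJ.
Qed.
End SymplecticOrder.

(** * Polarization identities *)

Lemma quadratic_form_polar (R : comNzRingType) m (S : 'M[R]_m) (x y : 'cV_m) : S^T = S ->
  ((x + y)^T *m S *m (x + y)) 0 0 =
  (x^T *m S *m x) 0 0 + (y^T *m S *m y) 0 0 + (x^T *m S *m y) 0 0 *+ 2.
Proof.
move=> S_sym; have -> : (x + y)^T = x^T + y^T by rewrite linearD.
rewrite !mulmxDl !mulmxDr.
have yx : (y^T *m S *m x) 0 0 = (x^T *m S *m y) 0 0.
  have -> : x^T *m S *m y = (y^T *m S *m x)^T.
    by rewrite !trmx_mul trmxK S_sym mulmxA.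
  by rewrite [RHS]mxE.
have mx11D (A B : 'M[R]_1) : (A + B) 0 0 = A 0 0 + B 0 0 by rewrite mxE.
by rewrite !mx11D yx mulr2n; ring.
Qed.

(** The last coordinate of the morphism identity for the lift of a similitude: [d] and [c] are the
    pairings before and after applying the matrix, [a] and [b] the values of the correcting
    quadratic form. *)
Lemma half_polarE (R : comNzRingType) (k l z t a b c d : R) : k * 2 = 1 ->
  l * (z + t + d) + k * (a + b + (c - l * d) *+ 2) =
  l * z + k * a + (l * t + k * b) + c.
Proof.
move=> k2; have -> : k * (a + b + (c - l * d) *+ 2) =
    k * a + k * b + (k * 2) * (c - l * d) by ring.
by rewrite k2; ring.
Qed.

(** * The similitude induced by an automorphism *)

Section ES1Aut.
Variables p n : nat.
Let G := [set: ES1 p n]%G.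
Local Notation J := (symplectic_form p n).
Implicit Types (s t : {perm (ES1 p n)}) (g h : ES1 p n).

Lemma AutT_morph s : s \in Aut G -> {morph s : g h / (g * h)%g}.
Proof. by move=> As g h; rewrite -!(autmE As) morphM ?in_setT. Qed.

Lemma AutTP s : reflect {morph s : g h / (g * h)%g} (s \in Aut G).
Proof.
apply: (iffP idP) => [|sM]; first exact: AutT_morph.
rewrite inE; apply/andP; split; first by apply/subsetP => g _; rewrite in_setT.
by apply/morphicP => g h _ _; apply: sM.
Qed.

Lemma ES1_vecE g : g = (usubmx (ES1_vec g), dsubmx (ES1_vec g), g.2).
Proof. by case: g => [[u w] z]; rewrite /ES1_vec /= col_mxKu col_mxKd. Qed.

Lemma ES1_vec_aut s g : s \in Aut G -> ES1_vec (s g) = ES1_bar s *m ES1_vec g.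
Proof.
move=> As; rewrite -(ES1_vec_coset (s g)) -induced_aut_coset // ES1_barE //.
by rewrite ES1_vec_coset.
Qed.

Lemma ES1_bar_eq s (M : 'M_(n + n)) : s \in Aut G ->
  (forall g, ES1_vec (s g) = M *m ES1_vec g) -> ES1_bar s = M.
Proof.
move=> As sM; apply/matrixP => i j.
have := sM (ES1_lift (delta_mx j 0)); rewrite ES1_vec_aut // ES1_liftK -!colE.
by move/matrixP/(_ i 0); rewrite !mxE.
Qed.

Lemma aut_comp_Aut s t : s \in Aut G -> t \in Aut G -> aut_comp s t \in Aut G.
Proof. by move=> As At; apply: groupM. Qed.

Lemma ES1_bar_comp s t : s \in Aut G -> t \in Aut G ->
  ES1_bar (aut_comp s t) = ES1_bar s *m ES1_bar t.
Proof.
move=> As At; apply: ES1_bar_eq => [|g]; first exact: aut_comp_Aut.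
by rewrite permM !ES1_vec_aut // mulmxA.
Qed.

Definition ES1_central (z : 'F_p) : ES1 p n := (0, 0, z).

Lemma ES1_centralD : {morph ES1_central : x y / x + y >-> (x * y)%g}.
Proof. by move=> x y; rewrite ES1_mulE /ES1_central /= ES1_pairing0r !addr0. Qed.

Lemma ES1_commute g h :
  (g * h)%g = (h * g * ES1_central (((ES1_vec g)^T *m J *m ES1_vec h) 0%R 0%R))%g.
Proof.
rewrite symplectic_formE /ES1_central; case: g h => [[u w] z] [[u' w'] z'].
rewrite /ES1_vec /= !ES1_mulE /= !col_mxKu !col_mxKd ES1_pairing0r !addr0.
by congr (_, _, _); rewrite 1?addrC //; ring.
Qed.

Lemma ES1_commute_center g h (c : 'F_p) :
  (g * h)%g = (h * g * ES1_central c)%g ->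
  ((ES1_vec g)^T *m J *m ES1_vec h) 0 0 = c.
Proof. by rewrite ES1_commute => /mulgI /(congr1 snd). Qed.

(** For an automorphism, the factor by which it multiplies the centre. *)
Definition ES1_scale s : 'F_p := (s (ES1_central 1)).2.

(** The vector part of the image is [ES1_bar s *m 0], so the image is again central, and an additive
    map of ['F_p] to itself is a multiplication. *)
Lemma Aut_central s (z : 'F_p) : s \in Aut G ->
  s (ES1_central z) = ES1_central (z * ES1_scale s).
Proof.
move=> As; pose c z := (s (ES1_central z)).2.
have sc z' : s (ES1_central z') = ES1_central (c z').
  rewrite [LHS]ES1_vecE ES1_vec_aut // {1 2}/ES1_vec /= col_mx0 mulmx0.
  by congr (_, _, _); apply/matrixP=> i j; rewrite !mxE.
have cD : {morph c : x y / x + y}.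
  by move=> x y; rewrite {1}/c ES1_centralD AutT_morph // !sc -ES1_centralD.
rewrite sc; congr ES1_central.
by rewrite -(Fp_additive_scalable (V := ('F_p)^o) cD) /GRing.scale /= mulr1.
Qed.

(** Applying [s] to the commutation relation of [g] and [h] scales its central term; the result must
    agree with the relation of [s g] and [s h]. *)
Lemma ES1_bar_form s : s \in Aut G ->
  (ES1_bar s)^T *m J *m ES1_bar s = ES1_scale s *: J.
Proof.
move=> As; apply: bilinear_mx_inj => x y.
have [g <-] : exists g, ES1_vec g = x by exists (ES1_lift x); rewrite ES1_liftK.
have [h <-] : exists h, ES1_vec h = y by exists (ES1_lift y); rewrite ES1_liftK.
have : (s g * s h = s h * s g *
    ES1_central (((ES1_vec g)^T *m J *m ES1_vec h) 0%R 0%R * ES1_scale s)%R)%g.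
  by rewrite -Aut_central // -!(AutT_morph As) -ES1_commute.
move/ES1_commute_center; rewrite !(ES1_vec_aut _ As) trmx_mul => e.
apply/matrixP=> i j; rewrite !ord1; rewrite !mulmxA in e *.
by rewrite e -scalemxAr -scalemxAl [RHS]mxE mulrC.
Qed.

Lemma ES1_scale_neq0 s : prime p -> s \in Aut G -> ES1_scale s != 0.
Proof.
move=> p_pr As; apply/eqP => sc0.
have : s (ES1_central 1) = s (ES1_central 0) by rewrite !Aut_central // sc0 !mulr0.
by move/perm_inj/(congr1 snd)/eqP; rewrite oner_eq0.
Qed.

Lemma ES1_bar_Sp_scalar s : prime p -> s \in Aut G -> ES1_bar s \in Sp_scalar p n.
Proof.
move=> p_pr As; apply/in_Sp_scalar; exists (ES1_scale s).
  exact: ES1_scale_neq0.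
exact: ES1_bar_form.
Qed.

Lemma ES1_pairingE (u w : 'cV['F_p]_n) : ES1_pairing u w = (u^T *m w) 0 0.
Proof. by rewrite mxE; apply: eq_bigr => i _; rewrite mxE. Qed.

(** * Lifting a similitude to an automorphism *)

Section AutOfSimilitude.
Hypotheses (p_prime : prime p) (p_odd : odd p).
Variables (M : 'M['F_p]_(n + n)) (l : 'F_p).
Hypotheses (l_neq0 : l != 0) (MJM : M^T *m J *m M = l *: J).
Let E : 'M['F_p]_(n + n) := block_mx 0 1%:M 0 0.
Let S := M^T *m E *m M - l *: E.

Lemma pairing_blockE (x y : 'cV['F_p]_(n + n)) :
  ES1_pairing (usubmx x) (dsubmx y) = (x^T *m E *m y) 0 0.
Proof.
rewrite -[in RHS](vsubmxK x) -[in RHS](vsubmxK y) tr_col_mx.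
rewrite mul_row_block mul_row_col !mulmx0 mulmx1 !addr0 mul0mx add0r.
by rewrite ES1_pairingE.
Qed.

Lemma symplectic_form_skew_part : J = E - E^T.
Proof.
rewrite /E tr_block_mx !trmx0 trmx1 opp_block_mx add_block_mx !oppr0.
by rewrite !addr0 add0r.
Qed.

(** As [J = E - E^T], the relation [MJM] says that [M^T *m E *m M - l *: E] equals its own
    transpose. *)
Lemma similitude_correction_sym : S^T = S.
Proof.
have e : M^T *m E *m M = l *: E - l *: E^T + M^T *m E^T *m M.
  rewrite -scalerBr -symplectic_form_skew_part -MJM symplectic_form_skew_part.
  by rewrite mulmxBr mulmxBl subrK.
have ST : S^T = M^T *m E^T *m M - l *: E^T.
  by rewrite linearB linearZ /= !trmx_mul trmxK mulmxA.
by rewrite ST /S e [RHS]addrC !addrA addNr add0r addrC.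
Qed.

(** [S] is the difference between the cocycle [E] pulled back along [M] and [E] scaled by [l]. Being
    symmetric, it is the coboundary of half its quadratic form, whence the last term. *)
Definition similitude_lift_fun g : ES1 p n :=
  let v := ES1_vec g in
  (usubmx (M *m v), dsubmx (M *m v), l * g.2 + 2^-1 * (v^T *m S *m v) 0 0).

Lemma Fp_two_neq0 : 2 != 0 :> 'F_p.
Proof.
rewrite -(dvdn_pcharf (pchar_Fp p_prime)) dvdn_prime2 //.
by apply: contraTneq p_odd => ->.
Qed.

Lemma similitude_lift_morph : {morph similitude_lift_fun : g h / (g * h)%g}.
Proof.
move=> g h; rewrite /similitude_lift_fun ES1_vecM ES1_mulE /=.
congr (_, _, _); try by rewrite mulmxDr linearD.
rewrite (quadratic_form_polar _ _ similitude_correction_sym) pairing_blockE.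
have -> : (ES1_mul g h).2 = g.2 + h.2 + ((ES1_vec g)^T *m E *m ES1_vec h) 0 0.
  rewrite -pairing_blockE /ES1_vec col_mxKu col_mxKd.
  by case: g h => [[u w] z] [[u' w'] z'].
move: (ES1_vec g) (ES1_vec h) g.2 h.2 => x y z t.
(* The cross term of the quadratic form trades the old pairing for the new one. *)
have SE : (x^T *m S *m y) 0 0 =
    ((M *m x)^T *m E *m (M *m y)) 0 0 - l * (x^T *m E *m y) 0 0.
  rewrite /S mulmxBr mulmxBl mxE [X in _ + X]mxE -scalemxAr -scalemxAl.
  by rewrite [X in _ - X]mxE trmx_mul !mulmxA.
rewrite [(x^T *m S *m y) 0 0]SE; apply: half_polarE.
by rewrite mulVf ?Fp_two_neq0.
Qed.

Lemma similitude_lift_inj : injective similitude_lift_fun.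
Proof.
have Mu : M \in unitmx.
  have : M \in Sp_scalar p n by apply/in_Sp_scalar; exists l.
  by rewrite inE => /andP[].
move=> g h egh; have evec : ES1_vec g = ES1_vec h.
  apply: (can_inj (mulKmx Mu)); rewrite -[LHS]vsubmxK -[RHS]vsubmxK.
  by have := congr1 (@ES1_vec p n) egh.
rewrite [g]ES1_vecE [h]ES1_vecE evec; congr (_, _, _).
have := congr1 snd egh; rewrite /= evec => /addIr; exact: mulfI.
Qed.

Definition similitude_lift : {perm (ES1 p n)} := perm similitude_lift_inj.

Lemma similitude_lift_Aut : similitude_lift \in Aut G.
Proof. by apply/AutTP => g h; rewrite !permE similitude_lift_morph. Qed.

Lemma ES1_bar_similitude_lift : ES1_bar similitude_lift = M.
Proof.
apply: ES1_bar_eq => [|g]; first exact: similitude_lift_Aut.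
by rewrite permE /ES1_vec /= vsubmxK.
Qed.
End AutOfSimilitude.
End ES1Aut.

(** * Inner automorphisms as the quotient by the centre *)

Section QuotientConj.
Variables (gT : finGroupType) (G : {group gT}).
Local Open Scope group_scope.

Lemma conj_aut_center z : z \in 'Z(G) -> conj_aut G z = 1.
Proof.
case/setIP => Gz Cz; apply/kerP; last by rewrite ker_conj_aut.
exact: subsetP (normG G) z Gz.
Qed.

(** The chosen representative differs from [g] by a central factor, which conjugates trivially. *)
Lemma quotient_conj_coset g : g \in G ->
  quotient_conj (coset 'Z(G) g) = conj_aut G g^-1.
Proof.
have NG := subsetP (normG G); have NZ := subsetP (normal_norm (center_normal G)).
move=> Gg; rewrite /quotient_conj.
have := mem_repr_coset (coset 'Z(G) g); rewrite val_coset ?NZ //.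
case/rcosetP => z Zz ->; have Gz := subsetP (center_sub G) z Zz.
have z1 : conj_aut_morphism G z^-1 = 1.
  by apply: conj_aut_center; rewrite groupV.
by rewrite invMg morphM ?NG ?groupV // z1 mulg1.
Qed.

Lemma mem_quotient_center x : x \in G / 'Z(G) -> exists2 g, g \in G & x = coset 'Z(G) g.
Proof. by case/morphimP => g _ Gg ->; exists g. Qed.

(** Inversion reverses products and so does [aut_comp]; the two reversals cancel. *)
Lemma quotient_conjM :
  {in G / 'Z(G) &, forall x y,
    quotient_conj (x * y) = aut_comp (quotient_conj x) (quotient_conj y)}.
Proof.
have NG := subsetP (normG G); have NZ := subsetP (normal_norm (center_normal G)).
move=> _ _ /mem_quotient_center[g Gg ->] /mem_quotient_center[h Gh ->].
rewrite -morphM ?NZ // !quotient_conj_coset ?groupM // invMg /aut_comp.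
by rewrite morphM ?NG ?groupV.
Qed.

Lemma quotient_conj_inj : {in G / 'Z(G) &, injective (@quotient_conj gT G)}.
Proof.
have NG := subsetP (normG G); have NZ := subsetP (normal_norm (center_normal G)).
move=> _ _ /mem_quotient_center[g Gg ->] /mem_quotient_center[h Gh ->].
rewrite !quotient_conj_coset // => eqgh.
have : g^-1 * h \in 'ker (conj_aut G).
  apply/kerP; first by rewrite NG ?groupM ?groupV.
  rewrite morphM ?NG ?groupV // [X in (X * _)%g]eqgh.
  rewrite -[X in (X * _)%g]/(conj_aut_morphism G _).
  by rewrite -morphM ?NG ?groupV // mulVg morph1.
rewrite ker_conj_aut => Cgh; have Zgh : g^-1 * h \in 'Z(G).
  by rewrite inE Cgh groupM ?groupV.
by rewrite -[h](mulKVg g) coset_kerr.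
Qed.

Lemma quotient_conj_im : quotient_conj (G := G) @: (G / 'Z(G)) = Inn G.
Proof.
have NG := subsetP (normG G).
apply/setP => s; apply/imsetP/morphimP => [[_ /mem_quotient_center[g Gg ->] ->] | ].
  by exists g^-1; rewrite ?NG ?groupV ?quotient_conj_coset.
case=> g _ Gg ->; exists (coset 'Z(G) g^-1).
  by rewrite mem_quotient ?groupV.
by rewrite quotient_conj_coset ?groupV ?invgK.
Qed.

Lemma card_Inn : #|Inn G| = #|G / 'Z(G)|.
Proof. by rewrite -quotient_conj_im card_in_imset //; apply: quotient_conj_inj. Qed.
End QuotientConj.

(** * Kernel and image of [ES1_bar], and the order of the automorphism group *)

Section ES1Exact.
Variables p n : nat.
Let G := [set: ES1 p n]%G.
Implicit Types (s t : {perm (ES1 p n)}) (g h : ES1 p n).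

Lemma conj_autT g h : conj_aut G g h = (h ^ g)%g.
Proof. by rewrite norm_conj_autE ?in_setT // (subsetP (normG G)) ?in_setT. Qed.

Lemma ES1_conjE (a b u w : 'cV['F_p]_n) (c z : 'F_p) :
  (((u, w, z) : ES1 p n) ^ ((a, b, c) : ES1 p n))%g =
  (u, w, ES1_pairing u b - ES1_pairing a w + z).
Proof.
apply: (mulgI ((a, b, c) : ES1 p n)); rewrite -conjgC !ES1_mulE /=.
by congr (_, _, _); rewrite 1?[LHS]addrC //; ring.
Qed.

Lemma Inn_bar1 s : s \in Inn G -> ES1_bar s = 1%:M.
Proof.
case/morphimP => g _ _ -> /=.
apply: ES1_bar_eq => [|h]; first by rewrite Aut_aut.
rewrite conj_autT mul1mx; case: g h => [[a b] c] [[u w] z].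
by rewrite ES1_conjE.
Qed.

Hypotheses (p_prime : prime p) (n_gt0 : (0 < n)%N).

(** The similitude relation becomes [J = l J], and [J] is nonzero because [n > 0]. *)
Lemma ES1_scale_bar1 s : s \in Aut G -> ES1_bar s = 1%:M -> ES1_scale s = 1.
Proof.
move=> As s1; have := ES1_bar_form As; rewrite s1 trmx1 mul1mx mulmx1.
rewrite -[LHS]scale1r => /scale_symplectic_form_inj -> //.
Qed.

Lemma Aut_bar1E s : s \in Aut G -> ES1_bar s = 1%:M ->
  exists alpha beta : {scalar 'cV['F_p]_n},
    forall u w z, s (u, w, z) = (u, w, alpha u + beta w + z).
Proof.
move=> As s1.
have sE g : s g = (g.1.1, g.1.2, (s g).2).
  rewrite [LHS]ES1_vecE ES1_vec_aut // s1 mul1mx.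
  by rewrite /ES1_vec col_mxKu col_mxKd.
have sM g h : (s (g * h)%g).2 = (s g).2 + (s h).2 + ES1_pairing g.1.1 h.1.2.
  by rewrite AutT_morph // (sE g) (sE h).
pose inu u : ES1 p n := (u, 0, 0); pose inw w : ES1 p n := (0, w, 0).
have inuD u u' : inu (u + u') = (inu u * inu u')%g.
  by rewrite ES1_mulE /= ES1_pairing0r !addr0.
have inwD w w' : inw (w + w') = (inw w * inw w')%g.
  by rewrite ES1_mulE /= ES1_pairing0l !addr0.
(* The pairing vanishes on the subgroups of the [(u, 0, 0)] and of the [(0, w, 0)], so these
   restrictions are additive. *)
pose a u := (s (inu u)).2; pose b w := (s (inw w)).2.
have aD : {morph a : x y / x + y}.
  by move=> u u'; rewrite {1}/a inuD sM ES1_pairing0r addr0.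
have bD : {morph b : x y / x + y}.
  by move=> w w'; rewrite {1}/b inwD sM ES1_pairing0l addr0.
have a_lin : linear_for *%R a by move=> k x y; rewrite aD (Fp_additive_scalable aD).
have b_lin : linear_for *%R b by move=> k x y; rewrite bD (Fp_additive_scalable bD).
pose alpha : {scalar 'cV['F_p]_n} :=
  HB.pack a (GRing.isLinear.Build 'F_p 'cV['F_p]_n 'F_p *%R a a_lin).
pose beta : {scalar 'cV['F_p]_n} :=
  HB.pack b (GRing.isLinear.Build 'F_p 'cV['F_p]_n 'F_p *%R b b_lin).
exists alpha, beta => u w z; rewrite sE /=; congr (_, _, _).
(* In this order the product creates no pairing term; the opposite order would add
   [ES1_pairing u w]. *)
have -> : (u, w, z) = (inw w * inu u * ES1_central n z)%g.
  by rewrite !ES1_mulE /= !ES1_pairing0r !addr0 !add0r.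
rewrite !sM Aut_central // ES1_scale_bar1 // mulr1 !ES1_pairing0r !addr0.
by rewrite [X in X + _]addrC.
Qed.

Lemma Inn_barP s : s \in Aut G -> s \in Inn G <-> ES1_bar s = 1%:M.
Proof.
move=> As; split=> [|s1]; first exact: Inn_bar1.
have [alpha [beta sE]] := Aut_bar1E As s1.
have scalarE (f : {scalar 'cV['F_p]_n}) x :
    f x = ES1_pairing x (\col_i f (delta_mx i 0)).
  rewrite {1}[x]matrix_sum_delta linear_sum; apply: eq_bigr => i _.
  by rewrite big_ord1 linearZ mxE.
(* Conjugation by [(a, b, c)] adds [ES1_pairing u b - ES1_pairing a w], so [b] must represent
   [alpha] and [- a] must represent [beta]. *)
pose g : ES1 p n := (- \col_i beta (delta_mx i 0), \col_i alpha (delta_mx i 0), 0).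
have -> : s = conj_aut G g.
  apply/permP => -[[u w] z]; rewrite conj_autT ES1_conjE sE ES1_pairingNl opprK.
  rewrite (scalarE alpha) (scalarE beta); congr (_, _, _ + _ + _).
  by apply: eq_bigr => i _; rewrite mulrC.
by rewrite mem_morphim ?in_setT // (subsetP (normG G)) ?in_setT.
Qed.

Lemma Aut_same_bar s t : s \in Aut G -> t \in Aut G ->
  (ES1_bar s == ES1_bar t) = ((s * t^-1)%g \in Inn G).
Proof.
move=> As At; have AV : (t^-1)%g \in Aut G by rewrite groupV.
have bar1 : ES1_bar (1%g : {perm (ES1 p n)}) = 1%:M.
  by apply: ES1_bar_eq => [|g]; rewrite ?group1 // perm1 mul1mx.
have tV : ES1_bar (t^-1)%g *m ES1_bar t = 1%:M.
  by rewrite -ES1_bar_comp // /aut_comp mulgV.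
have st : ES1_bar (s * t^-1)%g = ES1_bar (t^-1)%g *m ES1_bar s.
  by rewrite -ES1_bar_comp.
apply/eqP/idP => [eqst | /Inn_bar1].
  by apply/Inn_barP; rewrite ?groupM // st eqst.
have [tVu _] := mulmx1_unit tV.
by rewrite st -tV => /(can_inj (mulKmx tVu)).
Qed.

Hypothesis p_odd : odd p.

Lemma ES1_bar_im : @ES1_bar p n @: Aut G = Sp_scalar p n.
Proof.
apply/setP => M; apply/imsetP/idP => [[s As ->] | SpM].
  exact: ES1_bar_Sp_scalar.
have [l l0 MJM] := in_Sp_scalar M SpM.
exists (similitude_lift l0 MJM).
  exact: similitude_lift_Aut.
by rewrite ES1_bar_similitude_lift.
Qed.

Lemma card_ES1_quotient : #|G / 'Z(G)|%g = (p ^ (2 * n))%N.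
Proof.
have -> : #|G / 'Z(G)|%g = #|{: 'cV['F_p]_(n + n)}|.
  rewrite -cardsT -(card_imset _ (can_inj (@quot_vecK p n))).
  apply: eq_card => v; rewrite in_setT; apply/imsetP.
  exists (vec_quot v); last by rewrite vec_quotK.
  by rewrite mem_quotient ?in_setT.
by rewrite card_mx card_Fp // muln1 addnn mul2n.
Qed.

(** The fibre of [ES1_bar] through [t] is the coset of [Inn G] by [t], of the size of the quotient
    by the centre. *)
Lemma card_Aut_ES1 : #|Aut G| = (p ^ (2 * n) * #|Sp_scalar p n|)%N.
Proof.
rewrite mulnC -card_ES1_quotient -card_Inn.
apply: (@card_eq_fibers _ _ _ _ (@ES1_bar p n)) => [s As | M].
  exact: ES1_bar_Sp_scalar.
rewrite -ES1_bar_im => /imsetP[t At ->].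
rewrite -(card_imset (Inn G) (mulIg t)); apply: eq_card => s.
rewrite [LHS]inE; apply/andP/imsetP => [[As] | [c Ic ->]].
  by rewrite Aut_same_bar // => ?; exists (s * t^-1)%g; rewrite ?mulgKV.
have Ac : c \in Aut G.
  by case/morphimP: Ic => g _ _ ->; rewrite Aut_aut.
have Act : (c * t)%g \in Aut G by rewrite groupM.
by rewrite Aut_same_bar // mulgK.
Qed.

End ES1Exact.

Theorem corollary3p1 (p n : nat) (p_prime : prime p) (p_odd : odd p)
    (n_gt0 : (0 < n)%N) :
  let G := [set: ES1 p n]%G in
  [/\ (* (1) *)
      forall s : {perm (ES1 p n)}, s \in Aut G ->
        (s \in Inn G <-> ES1_bar s = 1%:M) /\
        (ES1_bar s = 1%:M ->
           exists alpha beta : {scalar 'cV['F_p]_n},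
             forall (u w : 'cV['F_p]_n) (z : 'F_p),
               s (u, w, z) = (u, w, alpha u + beta w + z)),
      (* (2) *)
      quotient_conj (G := G) @: (G / 'Z(G))%g = Inn G /\
      short_exact (G / 'Z(G))%g (fun x y => (x * y)%g)
                  (Aut G) (@aut_comp _)
                  (Sp_scalar p n) mulmx 1%:M
                  (quotient_conj (G := G)) (@ES1_bar p n)
    & (* (3) *)
      [/\ #|Aut G| = (p ^ (2 * n) * #|Sp_scalar p n|)%N,
          (p ^ (2 * n) * #|Sp_scalar p n|
             = p ^ (2 * n) * (p - 1) * #|Sp p n|)%N
        & (p ^ (2 * n) * (p - 1) * #|Sp p n|
             = p ^ (n ^ 2 + 2 * n) * (p - 1)
               * \prod_(1 <= j < n.+1) (p ^ (2 * j) - 1))%N]].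
Proof.
move=> G; split=> [s As | | ].
- by split; [exact: Inn_barP | exact: Aut_bar1E].
- split; first exact: quotient_conj_im.
  have Inn_Aut s : s \in Inn G -> s \in Aut G.
    by case/morphimP => g _ _ ->; rewrite Aut_aut.
  split.
  + by move=> x Gx; rewrite Inn_Aut // -quotient_conj_im imset_f.
  + exact: quotient_conjM.
  + exact: quotient_conj_inj.
  + by move=> s; apply: ES1_bar_Sp_scalar.
  + exact: ES1_bar_comp.
  + rewrite quotient_conj_im; apply/setP => s; rewrite inE.
    apply/idP/andP => [Is | [As /eqP]]; last by move/Inn_barP; apply.
    by rewrite Inn_Aut // Inn_bar1.
  + exact: ES1_bar_im.
- split; first exact: card_Aut_ES1.
    by rewrite card_Sp_scalar // mulnA.
  by rewrite card_Sp // expnD; lia.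
Qed.
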